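(* Let $p$ and $k$ be integers with $p>5$ and $p+2\leq k<p^2-3p+2$. Define $f:\mathbb{Z}_{\geq 0}\to\mathbb{Z}_{\geq 0}$ by $$f(x)=\begin{cases}\dfrac{(x+p-1)(x+2p-1)}{p^2}, & x\equiv 1 \pmod p,\\[2mm] \dfrac{x+p-j}{p}, & x\equiv j \pmod p,\ 2\leq j\leq p-1,\\[2mm] \dfrac{x}{p}, & x\equiv 0\pmod p.\end{cases}$$ For a positive integer $n$ with base-$k$ expansion $n=a_{m-1}k^{m-1}+\dots+a_1k+a_0$ (digits $0\leq a_i<k$, $a_{m-1}\neq 0$), let $\mathcal{Z}_k(n)=\sum_{i=0}^{m-1}f(a_i)$, and set $n_j=\mathcal{Z}_k^{j}(n)$ for $j\geq 0$ (the $j$-fold iterate, $n_0=n$). Then for every positive integer $n$ there exists a finite positive integer $\lambda$ such that $n_\mu\in\{1,2\}$ for all $\mu\geq\lambda$.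
   Context: $\mathcal{Z}_k$ is called the $\mathcal{Z}$ transformation in base $k$ and $(n_j)_{j\ge0}$ the $\mathcal{Z}$ transformation sequence of $n$. Note that $f(1)=2$ and $f(2)=1$. *)

(* Defs.v *)
From mathcomp Require Import all_boot.

Set Implicit Arguments.
Unset Strict Implicit.
Unset Printing Implicit Defensive.

(* All quotients are exact (see [zf_exact]) and, for [0 < p], no subtraction
   is truncated. *)
Definition zf (p x : nat) : nat :=
  if x %% p == 1 then ((x + p - 1) * (x + 2 * p - 1)) %/ p ^ 2
  else if x %% p == 0 then x %/ p
  else (x + p - x %% p) %/ p.

Definition digit (k n i : nat) : nat := (n %/ k ^ i) %% k.

(* [ndigits k n] is the number of base-[k] digits of [n > 0], for [1 < k]. *)
Definition ndigits (k n : nat) : nat := (trunc_log k n).+1.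

Definition zt (p k n : nat) : nat := \sum_(i < ndigits k n) zf p (digit k n i).

Lemma zf_exact (p x : nat) : 1 < p ->
  [/\ x %% p = 1 -> p ^ 2 %| (x + p - 1) * (x + 2 * p - 1),
      x %% p = 0 -> p %| x &
      p %| x + p - x %% p].
Proof.
move=> p_gt1; have p_gt0 := ltnW p_gt1; split.
- move=> x1; rewrite expnS expn1 dvdn_mul //.
  + rewrite {1}(divn_eq x p) x1 -addnA addnCA addKn.
    by rewrite dvdn_add ?dvdn_mull.
  + rewrite {1}(divn_eq x p) x1 -addnA addnCA addKn.
    by rewrite dvdn_add ?dvdn_mull.
- by move/eqP.
- rewrite {1}(divn_eq x p) -addnA addnCA addKn.
  by rewrite dvdn_add ?dvdn_mull.
Qed.

Lemma digitP (k n : nat) : 1 < k -> 0 < n ->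
  [/\ n = \sum_(i < ndigits k n) digit k n i * k ^ i,
      forall i, digit k n i < k &
      digit k n (ndigits k n).-1 != 0].
Proof.
move=> k_gt1 n_gt0; have k_gt0 := ltnW k_gt1.
have sumE m : n = \sum_(i < m) digit k n i * k ^ i + n %/ k ^ m * k ^ m.
  elim: m => [|m IHm]; first by rewrite big_ord0 expn0 divn1 muln1.
  rewrite {1}IHm big_ord_recr /= -addnA; congr (_ + _).
  rewrite {1}(divn_eq (n %/ k ^ m) k) mulnDl addnC -divnMA.
  by rewrite -mulnA -expnS -expnSr.
have /andP[lo hi] := trunc_log_bounds k_gt1 n_gt0.
split.
- by rewrite {1}(sumE (ndigits k n)) [_ %/ _]divn_small ?addn0.
- by move=> i; rewrite ltn_mod.
- rewrite /digit /= modn_small; last by rewrite ltn_divLR ?expn_gt0 ?k_gt0 // -expnS.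
  by rewrite -lt0n divn_gt0 ?expn_gt0 ?k_gt0.
Qed.

Lemma zf1 (p : nat) : 1 < p -> zf p 1 = 2.
Proof.
move=> p_gt1; rewrite /zf modn_small // eqxx !addKn mulnCA mulnn mulnK //.
by rewrite expn_gt0 ltnW.
Qed.

Lemma zf2 (p : nat) : 2 < p -> zf p 2 = 1.
Proof. by move=> p_gt2; rewrite /zf modn_small // addKn divnn (ltnW (ltnW p_gt2)). Qed.

(* Main.v *)
Require Import Defs.
From mathcomp Require Import all_boot zify.

(** On digits [x < k] one has [zf p x < x] except at [x = 0] and [x = 1]: for
    [x = q p + 1] the value is [(q + 1) (q + 2)], and the upper bound on [k]
    forces [q <= p - 4], which makes this smaller than [x] when [q > 0].  Hence
    [zf p x <= 2 x] on digits, and since [k > 3] the weight of the higher digits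
    absorbs this factor, so [zt p k n < n] for [n > 2]. *)

Lemma zf_modn1 (p q : nat) : 1 < p -> zf p (q * p + 1) = (q + 1) * (q + 2).
Proof.
move=> p_gt1; rewrite /zf modnMDl modn_small // eqxx.
have -> : q * p + 1 + p - 1 = (q + 1) * p by lia.
have -> : q * p + 1 + 2 * p - 1 = (q + 2) * p by lia.
by rewrite mulnACA mulnn mulnK // expn_gt0 ltnW.
Qed.

Lemma zf_modn_gt1 (p q r : nat) : 1 < r < p -> zf p (q * p + r) = q.+1.
Proof.
move=> /andP[r_gt1 r_ltp]; rewrite /zf modnMDl modn_small //.
rewrite !ifN_eq; try lia.
have -> : q * p + r + p - r = q.+1 * p by lia.
by rewrite mulnK //; lia.
Qed.

Lemma zf_modn0 (p q : nat) : 0 < p -> zf p (q * p) = q.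
Proof. by move=> p_gt0; rewrite /zf modnMl /= mulnK. Qed.

Lemma zf_gt0 (p x : nat) : 1 < p -> 0 < x -> 0 < zf p x.
Proof.
move=> p_gt1 x_gt0; have := divn_eq x p; have := ltn_pmod x (ltnW p_gt1).
move: (x %/ p) (x %% p) => q [|[|r]] r_ltp xE; rewrite xE in x_gt0 *.
- by rewrite addn0 zf_modn0; nia.
- by rewrite zf_modn1 //; nia.
- by rewrite zf_modn_gt1.
Qed.

Lemma zf_lt (p x : nat) : 5 < p -> 1 < x < p ^ 2 - 3 * p + 1 -> zf p x < x.
Proof.
move=> p_gt5; have p_gt1 : 1 < p by lia.
rewrite expnS expn1 => /andP[x_gt1 x_lt].
have := divn_eq x p; have := ltn_pmod x (ltnW p_gt1).
move: (x %/ p) (x %% p) => q [|[|r]] r_ltp xE; rewrite xE in x_gt1 x_lt *.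
- by rewrite addn0 zf_modn0; nia.
(* From [q * p + 1 < p * p - 3 * p + 1] follows [q < p - 3]. *)
- have q_le : q + 4 <= p by nia.
  have q_gt0 : 0 < q by case: (q) x_gt1.
  rewrite zf_modn1 //.
  have : q * (q + 4) <= q * p by rewrite leq_mul2l q_le orbT.
  (* The bound [q * (q + 4) + 1] on the digit exceeds [(q + 1) * (q + 2)] by [q - 1], which is no
     gain at [q = 1]; there [6 < p + 1] holds because [p > 5]. *)
  by have [->|q_gt1] : q = 1 \/ 1 < q; lia.
- by rewrite zf_modn_gt1 //; have := leq_pmulr q (ltnW p_gt1); lia.
Qed.

(** The additive bound serves the units digit, the multiplicative one the higher digits; both are
    attained at [x = 1]. *)
Lemma zf_le_succ_double (p x : nat) : 5 < p -> x < p ^ 2 - 3 * p + 1 ->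
  (zf p x <= x.+1) && (zf p x <= 2 * x).
Proof.
case: x => [|[|x]] p_gt5 x_lt; last by have := @zf_lt p x.+2 p_gt5; lia.
- by have := @zf_modn0 p 0; rewrite mul0n => ->; lia.
- by rewrite zf1; lia.
Qed.

Lemma zt_gt0 (p k n : nat) : 1 < p -> 1 < k -> 0 < n -> 0 < zt p k n.
Proof.
move=> p_gt1 k_gt1 n_gt0; have [_ _ top_neq0] := digitP k_gt1 n_gt0.
rewrite /zt big_ord_recr /= addn_gt0; apply/orP; right.
by rewrite zf_gt0 // lt0n.
Qed.

Lemma zt_digit (p k n : nat) : n < k -> zt p k n = zf p n.
Proof.
move=> n_ltk; rewrite /zt /ndigits.
have -> : trunc_log k n = 0.
  by apply/eqP; rewrite trunc_log_eq0; lia.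
by rewrite big_ord1 /digit expn0 divn1 modn_small.
Qed.

Lemma zt_lt (p k n : nat) : 5 < p -> p + 2 <= k < p ^ 2 - 3 * p + 2 ->
  2 < n -> zt p k n < n.
Proof.
move=> p_gt5 /andP[k_ge k_lt] n_gt2.
have [n_ltk|k_len] := ltnP n k; first by rewrite zt_digit // zf_lt //; lia.
have k_gt1 : 1 < k by lia.
have n_gt0 : 0 < n by lia.
have [nE d_ltk top_neq0] := digitP k_gt1 n_gt0.
have zfd i : zf p (digit k n i) <= (digit k n i).+1 /\
             zf p (digit k n i) <= 2 * digit k n i.
  by apply/andP/zf_le_succ_double => //; have := d_ltk i; lia.
have L_gt0 : 0 < trunc_log k n by rewrite trunc_log_gt0 k_gt1; lia.
rewrite /zt; rewrite /ndigits /= in nE top_neq0 *.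
rewrite [ltnRHS]nE !big_ord_recl /= expn0 muln1.
case: (trunc_log k n) L_gt0 top_neq0 => // L _ top_neq0.
(* With at least two digits, the nonzero leading digit is not the units digit. *)
have sum_gt0 : 0 < \sum_(i < L.+1) digit k n (lift ord0 i).
  by rewrite big_ord_recr /= addn_gt0 [X in _ || X]lt0n top_neq0 orbT.
(* The surplus of twice the higher digit sum, at least 2, outweighs the possible increase by 1 at
   the units digit. *)
have : \sum_(i < L.+1) zf p (digit k n (lift ord0 i))
       + \sum_(i < L.+1) digit k n (lift ord0 i) * 2
     <= \sum_(i < L.+1) digit k n (lift ord0 i) * k ^ lift ord0 i.
  rewrite -big_split; apply: leq_sum => i _ /=.
  have [_ zfd2] := zfd (bump 0 i).
  have : digit k n (bump 0 i) * 4 <= digit k n (bump 0 i) * k ^ bump 0 i.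
    rewrite leq_mul2l; apply/orP; right.
    have ki_gt0 : 0 < k ^ i by rewrite expn_gt0 ltnW.
    by rewrite expnS; nia.
  by lia.
rewrite -big_distrl; have [zfd0 _] := zfd 0.
by move: sum_gt0 zfd0 => /=; lia.
Qed.

(** Both 1 and 2 are single digits in base [k], and [zf p] swaps them. *)
Lemma zt_stable (p k n mu : nat) : 2 < p -> 2 < k -> n \in [:: 1; 2] ->
  iter mu (zt p k) n \in [:: 1; 2].
Proof.
move=> p_gt2 k_gt2 n12; elim: mu => //= mu; rewrite !inE.
case/orP=> /eqP->; rewrite zt_digit ?zf1 ?zf2 //; lia.
Qed.

Theorem theorem1 (p k : nat) (hp : 5 < p)
    (hk : p + 2 <= k < p ^ 2 - 3 * p + 2) (n : nat) (hn : 0 < n) :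
  exists lambda : nat, 0 < lambda /\
    forall mu : nat, lambda <= mu -> iter mu (zt p k) n \in [:: 1; 2].
Proof.
elim/ltn_ind: n hn => n IHn hn.
have [n_le2|n_gt2] := leqP n 2.
  exists 1; split=> // mu _; apply: zt_stable; rewrite ?inE; lia.
have zt_pos : 0 < zt p k n by apply: zt_gt0; lia.
have [l [_ stable]] := IHn _ (zt_lt _ _ _ hp hk n_gt2) zt_pos.
(* One more step than for [zt p k n], since [iterSr] peels off the first application. *)
by exists l.+1; split=> // -[//|mu] l_le; rewrite iterSr stable.
Qed.
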